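(* Let $A$ be a finite alphabet and let $\mu$ be an invariant sofic probability measure on a shift space over $A$. Let $n$ be the dimension of the minimal (reduced) linear representation of $\mu$, and set $K=2^{n^2-1}$. If $\mu$ is not a $K$-step Markov measure, then $\mu$ is not a $k$-step Markov measure for any integer $k\geqslant 1$.
   Context: Shift spaces: $A^{\mathbb{Z}}$ with the product topology and shift $S$, $(Sx)_i=x_{i+1}$; a shift space is a closed $S$-invariant subset $X\subseteq A^{\mathbb Z}$, $\mathcal L(X)$ its set of finite factors and $\mathcal L_k(X)$ those of length $k$. A shift of finite type is a shift space consisting of all sequences avoiding a finite set of words. A factor map is a surjective sliding block code $\phi\colon X\to Y$, $\phi(x)_i=f(x_{i-m}\cdots x_{i+n})$. For a probability measure $\mu$ on $X$, $\hat\mu(w)=\mu(\{x: x_0\cdots x_{|w|-1}=w\})$ for $w\in A^*$. A $1$-step Markov measure is defined by an irreducible stochastic $A\times A$ matrix $M$ and a stochastic row vector $v$ with $vM=v$, via $\hat\mu(a_1\cdots a_m)=v_{a_1}M_{a_1,a_2}\cdots M_{a_{m-1},a_m}$; it is viewed as a measure on any shift containing $X_M=\{x: M_{x_i,x_{i+1}}>0\ \forall i\}$. A probability measure $\nu$ on a shift space $Y$ is sofic if $\nu=\phi\mu$ (i.e. $\nu(U)=\mu(\phi^{-1}U)$) for a factor map $\phi\colon X\to Y$ from a shift of finite type $X$ and a $1$-step Markov measure $\mu$ on $X$. The $k$-th higher block code $\gamma_k$ maps $x$ to the sequence $y$ with $y_i=f(x_{i-k+1}\cdots x_i)$, where $f$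 is a bijection from $\mathcal L_k(X)$ onto a new alphabet $A_k$; a measure $\mu$ on $X$ is $k$-step Markov if its image under $\gamma_k$ is a $1$-step Markov measure. A linear representation of dimension $n$ of $\mu$ is a triple $(\lambda,\varphi,\gamma)$ with $\lambda\in\mathbb R^{1\times n}$, $\gamma\in\mathbb R^{n\times 1}$ and $\varphi$ a monoid morphism from $A^*$ to real $n\times n$ matrices such that $\hat\mu(w)=\lambda\varphi(w)\gamma$ for all $w\in A^*$. It is reduced if the vectors $\lambda\varphi(w)$, $w\in A^*$, span $\mathbb R^{1\times n}$ and the vectors $\varphi(w)\gamma$, $w\in A^*$, span $\mathbb R^{n}$; the reduced (minimal) representation is unique up to linear isomorphism, and its dimension is the smallest possible. *)

(* Defs.v *)
From HB Require Import structures.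
From mathcomp Require Import all_boot all_order all_algebra.
From mathcomp Require Import reals.
Set Implicit Arguments. Unset Strict Implicit. Unset Printing Implicit Defensive.
Import Order.TTheory GRing.Theory Num.Theory.
Local Open Scope ring_scope.

(* A shift-invariant Borel probability measure mu on A^Z is encoded by its
   cylinder function  muhat : seq A -> R,  muhat w = mu([w]_0)
   (Kolmogorov consistency + shift invariance characterise such functions). *)
Definition inv_prob (R : realType) (A : finType) (p : seq A -> R) : Prop :=
  [/\ p [::] = 1,
      (forall w, 0 <= p w),
      (forall w, p w = \sum_(a : A) p (rcons w a)) &
      (forall w, p w = \sum_(a : A) p (a :: w))].

Definition slide (T U : Type) (N : nat) (g : seq T -> U) (u : seq T) : seq U :=
  [seq g (take N (drop i u)) | i <- iota 0 ((size u).+1 - N)].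

Definition push (R : realType) (T U : finType) (N : nat) (g : seq T -> U)
  (q : seq T -> R) (w : seq U) : R :=
  \sum_(u : (size w + N - 1).-tuple T | slide N g u == w) q u.

Fixpoint trans (R : realType) (c : nat) (M : 'M[R]_c) (a : 'I_c) (w : seq 'I_c) : R :=
  if w is b :: w' then M a b * trans M b w' else 1.

Definition markov_cyl (R : realType) (c : nat) (M : 'M[R]_c) (v : 'rV[R]_c)
  (w : seq 'I_c) : R :=
  if w is a :: w' then v 0 a * trans M a w' else 1.

Definition stochastic_mx (R : realType) (c : nat) (M : 'M[R]_c) : Prop :=
  (forall i j, 0 <= M i j) /\ (forall i, \sum_j M i j = 1).

Definition irreducible_mx (R : realType) (c : nat) (M : 'M[R]_c) : Prop :=
  forall i j, exists k : nat, 0 < (M ^+ k.+1) i j.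

Definition markov_data (R : realType) (c : nat) (M : 'M[R]_c) (v : 'rV[R]_c) : Prop :=
  [/\ stochastic_mx M, irreducible_mx M,
      (forall j, 0 <= v 0 j), \sum_j v 0 j = 1 & v *m M = v].

Definition sofic (R : realType) (A : finType) (p : seq A -> R) : Prop :=
  exists (c : nat) (M : 'M[R]_c) (v : 'rV[R]_c) (N : nat) (g : seq 'I_c -> A),
    [/\ markov_data M v, (0 < N)%N & forall w, p w = push N g (markov_cyl M v) w].

(* k-step Markov: the image under the k-th higher block code
   y_i = f(x_{i-k+1} .. x_i), f a bijection from L_k(supp mu) onto the new
   alphabet 'I_b, is a 1-step Markov measure. *)
Definition k_markov (R : realType) (A : finType) (p : seq A -> R) (k : nat) : Prop :=
  exists (b : nat) (f : seq A -> 'I_b) (M : 'M[R]_b) (v : 'rV[R]_b),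
    [/\ markov_data M v,
        (forall u w, size u = k -> size w = k -> 0 < p u -> 0 < p w ->
           f u = f w -> u = w) &
        forall w, markov_cyl M v w = push k f p w].

Definition mxword (R : realType) (A : Type) (n : nat) (Phi : A -> 'M[R]_n)
  (w : seq A) : 'M[R]_n := foldr (fun a m => Phi a *m m) 1%:M w.

Definition lin_rep (R : realType) (A : finType) (p : seq A -> R) (n : nat)
  (lam : 'rV[R]_n) (Phi : A -> 'M[R]_n) (gam : 'cV[R]_n) : Prop :=
  forall w, p w = (lam *m mxword Phi w *m gam) 0 0.

Definition in_span (R : realType) (A : Type) (r s : nat)
  (F : seq A -> 'M[R]_(r, s)) (u : 'M[R]_(r, s)) : Prop :=
  exists (ws : seq (seq A)) (cs : seq R),
    u = \sum_(i < size ws) cs`_i *: F (nth [::] ws i).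

Definition reduced_rep (R : realType) (A : Type) (n : nat)
  (lam : 'rV[R]_n) (Phi : A -> 'M[R]_n) (gam : 'cV[R]_n) : Prop :=
  (forall u : 'rV[R]_n, in_span (fun w => lam *m mxword Phi w) u) /\
  (forall x : 'cV[R]_n, in_span (fun w => mxword Phi w *m gam) x).

(* Main.v *)
Require Import Defs.
From HB Require Import structures.
From mathcomp Require Import all_boot all_order all_algebra.
From mathcomp Require Import reals.
From mathcomp Require Import zify.
(** Only the order of the Markov dependence has to be controlled: a measure that
    is k-step Markov is irreducible, and irreducibility can be expressed without
    reference to k.  In a reduced representation the k-step Markov identity
    p(uwv) p(w) = p(uw) p(wv), for all |w| = k, says that every phi(w) with
    |w| = k has rank at most 1, i.e. that phi(w)^T B phi(w) = 0 for every
    alternating B.  The maps B |-> phi(a)^T B phi(a) act on the n^2-dimensional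
    space of matrices, where the subspaces annihilated by all words of length i
    increase with i and are stationary from i = n^2 on.  Hence the rank condition
    holds for all words of length at least n^2, in particular for those of length
    K = 2^(n^2-1) >= n^2. *)

Set Implicit Arguments.
Unset Strict Implicit.
Unset Printing Implicit Defensive.
Import Order.TTheory GRing.Theory Num.Theory.
Local Open Scope ring_scope.

(** * Combinatorics of sliding block codes *)

Lemma size_slide (T U : Type) N (g : seq T -> U) x :
  size (slide N g x) = ((size x).+1 - N)%N.
Proof. by rewrite size_map size_iota. Qed.

Lemma slide_small (T U : Type) N (g : seq T -> U) x :
  (size x < N)%N -> slide N g x = [::].
Proof. by rewrite /slide -subn_eq0 => /eqP ->. Qed.

Lemma slide_cons (T U : Type) N (g : seq T -> U) a x :
  (0 < N)%N -> (N <= (size x).+1)%N ->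
  slide N g (a :: x) = g (take N (a :: x)) :: slide N g x.
Proof.
move=> N0 leN; rewrite /slide /= subSn //=; congr (_ :: _).
by rewrite -[1%N]addn0 iotaDl -map_comp.
Qed.

Lemma drop_slide (T U : Type) N (g : seq T -> U) i x :
  (0 < N)%N -> drop i (slide N g x) = slide N g (drop i x).
Proof.
move=> N0; elim: x i => [|a x IHx] [|i]; rewrite ?drop0 //.
  by rewrite slide_small.
have [leN|ltN] := leqP N (size x).+1; first by rewrite slide_cons //= IHx.
rewrite slide_small //= slide_small // size_drop.
by rewrite (leq_ltn_trans (leq_subr _ _)) // ltnW.
Qed.

(** The windows at these first positions never reach into [y]; for [x] shorter than a window the
    truncated subtraction gives 0. *)
Lemma take_slide_cat (T U : Type) N (g : seq T -> U) x y :
  (0 < N)%N -> take ((size x).+1 - N) (slide N g (x ++ y)) = slide N g x.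
Proof.
move=> N0; elim: x => [|a x IHx].
  by case: N N0 => // N _; rewrite take0.
have [leN|ltN] := leqP N (size x).+1.
  rewrite cat_cons !slide_cons //; last first.
    by rewrite size_cat (leq_trans leN) // ltnS leq_addr.
  rewrite [size _]/= subSn //= IHx -cat_cons takel_cat //.
by rewrite [RHS]slide_small // (eqP (_ : (size (a :: x)).+1 - N == 0)%N) ?take0.
Qed.

Lemma slide_self (T U : Type) N (g : seq T -> U) x :
  size x = N -> (0 < N)%N -> slide N g x = [:: g x].
Proof.
case: x => [|a x] <- // _; rewrite slide_cons //= take_size.
by rewrite slide_small.
Qed.

(** An overlap of exactly one window contributes exactly one code letter. Words glued along [w] thus
    become code words glued along [g w], where Markov cylinders factor. *)
Lemma slide_split (T U : Type) N (g : seq T -> U) u w v :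
  size w = N -> (0 < N)%N ->
  exists s t, [/\ slide N g (u ++ w ++ v) = s ++ g w :: t,
                  slide N g (u ++ w) = rcons s (g w) &
                  slide N g (w ++ v) = g w :: t].
Proof.
move=> sw N0; elim: u => [|a u [s [t [e1 e2 e3]]]].
  exists [::], (behead (slide N g (w ++ v))); rewrite [slide N g ([::] ++ w)]slide_self //=.
  suff e : slide N g (w ++ v) = g w :: behead (slide N g (w ++ v)) by split.
  case: w sw => [e|a w sw]; first by rewrite -e in N0.
  rewrite cat_cons slide_cons //=; last by rewrite size_cat -sw /= ltnS leq_addr.
  by rewrite -cat_cons -sw take_size_cat.
exists (g (take N (a :: u ++ w)) :: s), t; split=> //.
- rewrite cat_cons slide_cons ?e1 //; last first.
    by rewrite !size_cat sw addnCA ltnW // ltnS leq_addr.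
  by rewrite catA -!cat_cons takel_cat //= size_cat sw ltnW // ltnS leq_addl.
- by rewrite cat_cons slide_cons ?e2 // size_cat sw ltnW // ltnS leq_addl.
Qed.

Lemma sum_gt0_ex (R : numDomainType) (I : finType) (P : pred I) (F : I -> R) :
  (forall i, P i -> 0 <= F i) -> 0 < \sum_(i | P i) F i ->
  exists2 i, P i & 0 < F i.
Proof.
move=> F0 /lt0r_neq0/eqP/(psumr_neq0P F0)[i /andP[Pi Fi]].
by exists i.
Qed.

(** * Words under an invariant measure, and block codes that are faithful on positive words *)

Section Words.
Context (R : realType) (A : finType) (p : seq A -> R).
Hypothesis Ip : inv_prob p.

Lemma word_ge0 u : 0 <= p u. Proof. by case: Ip. Qed.

Lemma word_cat_lel u v : p (u ++ v) <= p u.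
Proof.
case: Ip => _ p0 pr _; elim: v u => [|a v IHv] u; first by rewrite cats0.
rewrite -cat_rcons (le_trans (IHv _)) // (pr u) (bigD1 a) //= lerDl.
exact: sumr_ge0.
Qed.

Lemma word_cat_ler u v : p (u ++ v) <= p v.
Proof.
case: Ip => _ p0 _ pl; elim: u => [|a u IHu] //=.
rewrite (le_trans _ IHu) // (pl (u ++ v)) (bigD1 a) //= lerDl.
exact: sumr_ge0.
Qed.

Lemma word_gt0_catl u v : 0 < p (u ++ v) -> 0 < p u.
Proof. by move/lt_le_trans; apply; apply: word_cat_lel. Qed.

Lemma word_gt0_catr u v : 0 < p (u ++ v) -> 0 < p v.
Proof. by move/lt_le_trans; apply; apply: word_cat_ler. Qed.

Lemma word_le0 u : ~~ (0 < p u) -> p u = 0.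
Proof. by rewrite lt0r word_ge0 andbT negbK => /eqP. Qed.

Lemma word_extend_right u m : 0 < p u -> exists r, size r = m /\ 0 < p (u ++ r).
Proof.
case: Ip => _ p0 pr _; elim: m u => [|m IHm] u pu.
  by exists [::]; rewrite cats0.
have [a _ pa] : exists2 a, true & 0 < p (rcons u a).
  by apply: sum_gt0_ex => //; rewrite -pr.
by have [r [<- pr']] := IHm _ pa; exists (a :: r); rewrite -cat_rcons.
Qed.

Lemma word_extend_left u m : 0 < p u -> exists l, size l = m /\ 0 < p (l ++ u).
Proof.
case: Ip => _ p0 _ pl; elim: m u => [|m IHm] u pu; first by exists [::].
have [a _ pa] : exists2 a, true & 0 < p (a :: u).
  by apply: sum_gt0_ex => //; rewrite -pl.
have [l [<- pl']] := IHm _ pa.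
by exists (rcons l a); rewrite size_rcons cat_rcons.
Qed.

(* A block code is only injective on words of positive measure, so [slide k f]
   is faithful on words all of whose length-k factors are positive, whether or not
   the word itself has positive measure. *)
Definition pos_factors k x := all id (slide k (fun y => 0 < p y) x).

Lemma pos_factors_gt0 k x : (0 < k)%N -> 0 < p x -> pos_factors k x.
Proof.
move=> k0; rewrite /pos_factors; elim: x => [|a x IHx] px.
  by rewrite slide_small.
have [lek|ltk] := leqP k (size x).+1; last by rewrite slide_small.
rewrite slide_cons //=; apply/andP; split; last exact/IHx/(word_gt0_catr (u := [:: a])).
by apply: (word_gt0_catl (v := drop k (a :: x))); rewrite cat_take_drop.
Qed.

(** A window of length [k] cannot meet both [u] and [v], since [w] between them already has length
    [k]. *)
Lemma pos_factors_cat k u w v : size w = k -> (0 < k)%N ->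
  pos_factors k (u ++ w) -> pos_factors k (w ++ v) -> pos_factors k (u ++ w ++ v).
Proof.
move=> sw k0; rewrite /pos_factors.
have [s [t [-> -> ->]]] := slide_split (fun y => 0 < p y) u v sw k0.
by rewrite all_rcons all_cat /= => /andP[-> ->] /andP[_ ->].
Qed.

Section Block.
Context (k : nat) (U : finType) (f : seq A -> U).
Hypothesis k0 : (0 < k)%N.
Hypothesis finj : forall u w, size u = k -> size w = k ->
  0 < p u -> 0 < p w -> f u = f w -> u = w.

(** Equal first code letters give equal first windows, hence equal first letters; induction handles
    the tail, until a single window covers the whole word. *)
Lemma slide_inj x y : size x = size y -> (k <= size x)%N ->
  pos_factors k x -> pos_factors k y -> slide k f x = slide k f y -> x = y.
Proof.
rewrite /pos_factors; elim: x y => [|a x IHx] [|b y] //= [sxy] lek.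
have lek' : (k <= (size y).+1)%N by rewrite -sxy.
rewrite !slide_cons //= => /andP[px gx] /andP[py gy] [efk es].
have etk : take k (a :: x) = take k (b :: y).
  by apply: finj => //; rewrite size_takel.
have [ltk|gek] := leqP k (size x).
  rewrite (IHx y) //; congr (_ :: _).
  by case: (k) k0 etk => //= k' _ [].
by move: etk; rewrite !take_oversize //= -sxy.
Qed.

Lemma pushE m (q : seq A -> R) (w : seq U) : m = (size w + k - 1)%N ->
  push k f q w = \sum_(u : m.-tuple A | slide k f u == w) q u.
Proof. by move->. Qed.

(** Every other preimage of this code word is null: a positive one has positive windows, so it would
    equal [x] by injectivity. *)
Lemma push_slide x : (k <= size x)%N -> pos_factors k x ->
  push k f p (slide k f x) = p x.
Proof.
move=> lek gx; rewrite (pushE (m := size x)); last first.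
  by rewrite size_slide subnK ?subn1 // ltnW.
rewrite (bigD1 (in_tuple x)) //= big1 ?addr0 // => y /andP[/eqP sy ny].
apply: word_le0; apply: contra ny => py; apply/eqP/val_inj => /=.
by apply: slide_inj; rewrite ?size_tuple //; apply: pos_factors_gt0.
Qed.

Lemma push_gt0 w : 0 < push k f p w ->
  exists x, [/\ size x = (size w + k - 1)%N, 0 < p x & slide k f x = w].
Proof.
move=> /sum_gt0_ex [x _|x /eqP sx px]; first exact: word_ge0.
by exists x; rewrite size_tuple.
Qed.

End Block.
End Words.

(** * Weights of paths and powers of the transition matrix *)

Lemma trans_cat (R : realType) c (M : 'M[R]_c) a s b t :
  trans M a (s ++ b :: t) = trans M a (rcons s b) * trans M b t.
Proof. by elim: s a => [|d s IHs] a /=; rewrite ?mulr1 // IHs mulrA. Qed.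

Lemma markov_cyl_cat (R : realType) c (M : 'M[R]_c) v s b t :
  markov_cyl M v (s ++ b :: t) = markov_cyl M v (rcons s b) * trans M b t.
Proof. by case: s => [|a s] /=; rewrite ?mulr1 // trans_cat mulrA. Qed.

Lemma trans_ge0 (R : realType) c (M : 'M[R]_c) a w :
  (forall i j, 0 <= M i j) -> 0 <= trans M a w.
Proof. by move=> M0; elim: w a => //= b w IHw a; rewrite mulr_ge0. Qed.

Lemma expmx_ge0 (R : realType) c (M : 'M[R]_c) l i j :
  (forall i j, 0 <= M i j) -> 0 <= (M ^+ l) i j.
Proof.
move=> M0; elim: l i j => [|l IHl] i j; first by rewrite expr0 mxE ler0n.
by rewrite exprS mxE sumr_ge0 // => h _; rewrite mulr_ge0.
Qed.

(** The path [a :: w] is one of the nonnegative terms in the expansion of the matrix power. *)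
Lemma trans_expmx (R : realType) c (M : 'M[R]_c) a w :
  (forall i j, 0 <= M i j) -> trans M a w <= (M ^+ size w) a (last a w).
Proof.
move=> M0; elim: w a => [|b w IHw] a /=; first by rewrite expr0 mxE eqxx.
rewrite exprS mxE (bigD1 b) //= (le_trans (ler_wpM2l _ (IHw b))) // lerDl.
by rewrite sumr_ge0 // => h _; rewrite mulr_ge0 // expmx_ge0.
Qed.

Lemma expmx_trans (R : realType) c (M : 'M[R]_c) a b l :
  (forall i j, 0 <= M i j) -> 0 < (M ^+ l.+1) a b ->
  exists2 w, size w = l & 0 < trans M a (rcons w b).
Proof.
move=> M0; elim: l a => [|l IHl] a.
  by rewrite expr1; exists [::] => //=; rewrite mulr1.
rewrite exprS mxE => /sum_gt0_ex[h _|d _ pd].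
  by rewrite mulr_ge0 // expmx_ge0.
have pM : 0 < M a d.
  by rewrite lt0r M0 andbT; apply: contraTneq pd => ->; rewrite mul0r ltxx.
have [w <- pw] : exists2 w, size w = l & 0 < trans M d (rcons w b).
  by apply: IHl; rewrite pmulr_rgt0 in pd.
by exists (d :: w) => //=; rewrite mulr_gt0.
Qed.

(** * Conditional independence and irreducibility of a k-step Markov measure *)

Section MarkovProperties.
Context (R : realType) (A : finType) (p : seq A -> R) (k : nat).
Hypotheses (Ip : inv_prob p) (k0 : (0 < k)%N) (Mp : k_markov p k).

(** The block code turns [w] into one letter, and the Markov cylinder factors at that letter. *)
Lemma k_markov_cond u w v : size w = k ->
  p (u ++ w ++ v) * p w = p (u ++ w) * p (w ++ v).
Proof.
move=> sw; have [b [f [M [pi [_ finj cylE]]]]] := Mp.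
have pE x : (k <= size x)%N -> pos_factors p k x ->
    p x = markov_cyl M pi (slide k f x).
  by move=> lek gx; rewrite cylE push_slide.
(* A null window in [u ++ w] makes [u ++ w] and its extension null, so both sides vanish; the same
   is done below for [w ++ v]. *)
case guw: (pos_factors p k (u ++ w)); last first.
  have uw0 : p (u ++ w) = 0.
    by apply: (word_le0 Ip); apply: contraFN guw; apply: pos_factors_gt0.
  rewrite uw0 mul0r; apply/eqP; rewrite mulf_eq0 eq_le (word_ge0 Ip) andbT.
  by rewrite -uw0 catA (word_cat_lel Ip).
case gwv: (pos_factors p k (w ++ v)); last first.
  have wv0 : p (w ++ v) = 0.
    by apply: (word_le0 Ip); apply: contraFN gwv; apply: pos_factors_gt0.
  rewrite wv0 mulr0; apply/eqP; rewrite mulf_eq0 eq_le (word_ge0 Ip) andbT.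
  by rewrite -wv0 (word_cat_ler Ip).
have gw : pos_factors p k w.
  move: guw; rewrite /pos_factors.
  have [s [t [_ -> _]]] := slide_split (fun y => 0 < p y) u v sw k0.
  by rewrite slide_self // all_rcons /= => /andP[->].
rewrite !pE ?size_cat ?sw ?leq_addl ?leq_addr //; last first.
- exact: pos_factors_cat.
- by rewrite addnCA leq_addr.
have [s [t [-> -> ->]]] := slide_split f u v sw k0.
rewrite slide_self // markov_cyl_cat /= mulr1 -mulrA; congr (_ * _).
by rewrite mulrC.
Qed.

(* The occurrences of u and w in x may overlap; size u < size x still forces at
   least one transition between the blocks u and w. *)
Lemma k_markov_connected u w : 0 < p u -> 0 < p w ->
  exists x, [/\ 0 < p x, (size u < size x)%N, prefix u x & suffix w x].
Proof.
move=> pu pw; have [b [f [M [pi [Md finj cylE]]]]] := Mp.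
have [[M0 _] Mirr pi0 _ _] := Md.
have pE x : (k <= size x)%N -> pos_factors p k x ->
    p x = markov_cyl M pi (slide k f x).
  by move=> lek gx; rewrite cylE push_slide.
(* Since [u] and [w] may be shorter than a window, they are padded so that both codes are nonempty,
   the first ending in [f r] and the second starting with [f l]. *)
have [r [sr pur]] := word_extend_right Ip k pu.
have [l [sl plw]] := word_extend_left Ip k pw.
have [s es] : exists s, slide k f (u ++ r) = rcons s (f r).
  by have [s [t [_ -> _]]] := slide_split f u [::] sr k0; exists s.
have [t et] : exists t, slide k f (l ++ w) = f l :: t.
  by have [s' [t [_ _ ->]]] := slide_split f [::] w sl k0; exists t.
have [j pj] := Mirr (f r) (f l).
have [c sc pc] := expmx_trans M0 pj.
have pt : 0 < trans M (f l) t.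
  have := plw; rewrite pE ?size_cat ?sl ?leq_addr ?pos_factors_gt0 // et /=.
  rewrite !lt0r trans_ge0 // andbT mulf_eq0 negb_or; by case/andP => /andP[].
(* The two codes joined by the connecting path [c] have positive measure; a positive preimage of
   this code word is the required [x]. *)
have : 0 < push k f p (slide k f (u ++ r) ++ c ++ slide k f (l ++ w)).
  rewrite -cylE es et cat_rcons markov_cyl_cat trans_cat.
  rewrite -es -pE ?size_cat ?sr ?leq_addl ?pos_factors_gt0 //.
  by rewrite !mulr_gt0.
case/(push_gt0 Ip) => x [sx px ex].
have {}sx : size x = (size u + (j + (size w + k)).+1)%N.
  rewrite sx !size_cat !size_slide !size_cat sr sl sc; lia.
have gtk (y z : seq A) : 0 < p (y ++ z) -> pos_factors p k y /\ pos_factors p k z.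
  by move=> pyz; split; apply: pos_factors_gt0 => //;
    [apply: word_gt0_catl pyz | apply: word_gt0_catr pyz].
exists x; split=> //; first by rewrite sx; lia.
- have leur : (size (u ++ r) <= size x)%N.
    rewrite size_cat sr sx; lia.
  have [gt _] := gtk (take (size (u ++ r)) x) (drop (size (u ++ r)) x)
                  (eq_ind_r (fun z => 0 < p z) px (cat_take_drop _ _)).
  (* This prefix of [x] has the same code as [u ++ r], and the code is injective on words with
     positive windows. *)
  have ext : take (size (u ++ r)) x = u ++ r.
    apply: (slide_inj k0 finj) => //.
    + by rewrite size_takel.
    + by rewrite size_takel // size_cat sr leq_addl.
    + exact: pos_factors_gt0.
    rewrite -(take_slide_cat f _ (drop (size (u ++ r)) x)) // cat_take_drop.
    by rewrite size_takel // ex -(size_slide k f) take_size_cat.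
  by apply/prefixP; exists (r ++ drop (size (u ++ r)) x); rewrite -[LHS](cat_take_drop (size (u ++ r))) ext -catA.
- set i := (size x - size (l ++ w))%N.
  have lelw : (size (l ++ w) <= size x)%N.
    rewrite size_cat sl sx; lia.
  have [_ gd] := gtk (take i x) (drop i x)
                  (eq_ind_r (fun z => 0 < p z) px (cat_take_drop _ _)).
  have exd : drop i x = l ++ w.
    apply: (slide_inj k0 finj) => //.
    + by rewrite size_drop subKn.
    + by rewrite size_drop subKn // size_cat sl leq_addr.
    + exact: pos_factors_gt0.
    rewrite -drop_slide // ex catA drop_size_cat //.
    rewrite size_cat !size_slide !size_cat sr sc /i sx size_cat sl; lia.
  by apply/suffixP; exists (take i x ++ l); rewrite -catA -exd cat_take_drop.
Qed.

End MarkovProperties.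

(** * Vectors annihilated by all words of a given length *)

Section Annihilator.
Context (K : fieldType) (V : vectType K) (A : finType) (h : A -> 'End(V)).
Let act (x : V) (w : seq A) := foldl (fun y a => h a y) x w.

(** Each level arises from the previous one by the same operation, so a single equality of
    consecutive levels propagates to all later ones. *)
Fixpoint annihilated i : {vspace V} :=
  if i is j.+1 then (\bigcap_(a : A) (h a @^-1: annihilated j))%VS else 0%VS.

Lemma annihilatedP i x :
  reflect (forall w, size w = i -> act x w = 0) (x \in annihilated i).
Proof.
apply: (iffP idP).
  elim: i x => [|i IHi] x /= xN [|a w] //=; first by move: xN; rewrite memv0 => /eqP.
  case=> sw; apply: IHi => //.
  by move: xN; rewrite memvE => /subv_bigcapP/(_ a isT); rewrite -memvE -memv_preim.
elim: i x => [|i IHi] x H /=; first by rewrite memv0; apply/eqP/(H [::]).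
rewrite memvE; apply/subv_bigcapP => a _; rewrite -memvE -memv_preim.
by apply: IHi => w sw; apply: (H (a :: w)); rewrite /= sw.
Qed.

(** The first [i] letters already give zero, and linear maps keep it zero. *)
Lemma annihilated_sub i j : (i <= j)%N -> (annihilated i <= annihilated j)%VS.
Proof.
move=> leij; apply/subvP => x /annihilatedP H; apply/annihilatedP => w sw.
have -> : act x w = act (act x (take i w)) (drop i w).
  by rewrite /act -foldl_cat cat_take_drop.
rewrite H ?size_takel ?sw //.
by elim: (drop i w) => //= a w' IH; rewrite linear0.
Qed.

Lemma annihilated_stable i j :
  annihilated i = annihilated i.+1 -> annihilated (i + j) = annihilated i.
Proof.
move=> e; elim: j => [|j IHj]; first by rewrite addn0.
by rewrite addnS /= IHj {2}e.
Qed.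

Lemma annihilated_max i j : (\dim {:V} <= j)%N ->
  (annihilated i <= annihilated j)%VS.
Proof.
move=> lej.
have [m lem em] : exists2 m, (m <= \dim {:V})%N & annihilated m = annihilated m.+1.
  (* As long as no two consecutive levels agree, every step raises the dimension by at least one. *)
  have grow l : (exists2 m, (m < l)%N & annihilated m = annihilated m.+1) \/
      (l <= \dim (annihilated l))%N.
    elim: l => [|l [[m ltm em]|lel]]; first by right.
      by left; exists m => //; apply: ltnW.
    have [e|ne] := eqVneq (annihilated l) (annihilated l.+1).
      by left; exists l.
    right; apply: leq_ltn_trans lel _; rewrite ltn_neqAle dimvS ?annihilated_sub // andbT.
    by apply: contra ne => ed; rewrite eqEdim annihilated_sub //= (eqP ed).
  have [[m ltm em]|] := grow (\dim {:V}).+1; first by exists m.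
  by move/leq_trans/(_ (dimvS (subvf _))); rewrite ltnn.
have [leij|ltji] := leqP i j; first exact: annihilated_sub.
have leml := leq_trans lem lej.
by rewrite -(subnKC leml) -(subnKC (leq_trans leml (ltnW ltji))) !annihilated_stable.
Qed.

Lemma foldl_lin_eq0 i x : (forall w, size w = i -> foldl (fun y a => h a y) x w = 0) ->
  forall w, (\dim {:V} <= size w)%N -> foldl (fun y a => h a y) x w = 0.
Proof.
move=> H w lew.
by have /annihilatedP/(_ w erefl) := subvP (annihilated_max i lew) x (introT (annihilatedP _ _) H).
Qed.

End Annihilator.

(** * Congruence action on bilinear forms, and the Markov identity in a linear representation *)

Section Representation.
Context (R : realType) (A : finType) (p : seq A -> R) (n : nat).
Context (lam : 'rV[R]_n) (Phi : A -> 'M[R]_n) (gam : 'cV[R]_n).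

Lemma mxword_cat (u w : seq A) : mxword Phi (u ++ w) = mxword Phi u *m mxword Phi w.
Proof. by elim: u => [|a u IHu] /=; rewrite ?mul1mx // IHu mulmxA. Qed.

(** The change of variables by [Phi a] in the bilinear form with matrix [B]. *)
Definition pullback a (B : 'M[R]_n) := (Phi a)^T *m B *m Phi a.

Fact pullback_is_linear a : linear (pullback a).
Proof.
by move=> c B C; rewrite /pullback mulmxDr mulmxDl -scalemxAr -scalemxAl.
Qed.

HB.instance Definition _ a :=
  GRing.isLinear.Build R 'M[R]_n 'M[R]_n _ (pullback a) (pullback_is_linear a).

Lemma foldl_pullback B w :
  foldl (fun C a => linfun (pullback a) C) B w = (mxword Phi w)^T *m B *m mxword Phi w.
Proof.
elim: w B => [|a w IHw] B /=; first by rewrite trmx1 mul1mx mulmx1.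
by rewrite IHw lfunE /= /pullback trmx_mul !mulmxA.
Qed.

(** The bound [n ^ 2] is the dimension of the space of matrices on which the letters act. *)
Lemma congr_mxword_eq0 i B :
  (forall w, size w = i -> (mxword Phi w)^T *m B *m mxword Phi w = 0) ->
  forall w, (n ^ 2 <= size w)%N -> (mxword Phi w)^T *m B *m mxword Phi w = 0.
Proof.
move=> H w lew; rewrite -foldl_pullback; apply: (@foldl_lin_eq0 _ _ _ _ i).
  by move=> w' sw; rewrite foldl_pullback H.
by rewrite dimvf /dim /= mulnn.
Qed.

(** By the two spanning conditions the bilinear form of [X] vanishes on all vectors; unit vectors
    then recover its entries. *)
Lemma reduced_rep_mx_eq0 (X : 'M[R]_n) : reduced_rep lam Phi gam ->
  (forall u v, (lam *m mxword Phi u) *m X *m (mxword Phi v *m gam) = 0) -> X = 0.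
Proof.
move=> [spanl spanr] H.
have Hl (y : 'rV_n) v : y *m X *m (mxword Phi v *m gam) = 0.
  have [ws [cs ->]] := spanl y; rewrite !mulmx_suml big1 // => i _.
  by rewrite -!scalemxAl H scaler0.
have Hr (y : 'rV_n) (x : 'cV_n) : y *m X *m x = 0.
  have [ws [cs ->]] := spanr x; rewrite !mulmx_sumr big1 // => i _.
  by rewrite -!scalemxAr Hl scaler0.
apply/matrixP => i j; have /matrixP/(_ 0 0) := Hr (delta_mx 0 i) (delta_mx j 0).
by rewrite -rowE -colE !mxE.
Qed.

Hypotheses (Ip : inv_prob p) (Lp : lin_rep p lam Phi gam).

Lemma repE w : lam *m mxword Phi w *m gam = (p w)%:M.
Proof. by rewrite [LHS]mx11_scalar -Lp. Qed.

Lemma rep_cat3E u w v :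
  lam *m mxword Phi u *m mxword Phi w *m (mxword Phi v *m gam) = (p (u ++ w ++ v))%:M.
Proof. by rewrite -repE !mxword_cat !mulmxA. Qed.

Lemma markov_cond_congr k (x y : 'rV[R]_n) : reduced_rep lam Phi gam ->
  (forall u w v, size w = k -> p (u ++ w ++ v) * p w = p (u ++ w) * p (w ++ v)) ->
  forall w, size w = k ->
  (mxword Phi w)^T *m (x^T *m y - y^T *m x) *m mxword Phi w = 0.
Proof.
move=> red cond w sw.
(* If [w] is null, so is every [u ++ w ++ v], and reducedness forces the matrix of [w] to be
   zero. *)
have [pw0|pw] := eqVneq (p w) 0.
  suff -> : mxword Phi w = 0 by rewrite mulmx0.
  apply: reduced_rep_mx_eq0 red _ => u v.
  rewrite rep_cat3E (_ : p _ = 0) ?raddf0 //; apply/eqP.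
  rewrite eq_le (word_ge0 Ip) andbT -pw0.
  exact: le_trans (word_cat_ler Ip _ _) (word_cat_lel Ip _ _).
(* Tested against the spanning vectors, this identity is exactly the Markov condition at [w]. *)
have rank1 : p w *: mxword Phi w = mxword Phi w *m (gam *m lam) *m mxword Phi w.
  apply/eqP; rewrite -subr_eq0; apply/eqP.
  apply: reduced_rep_mx_eq0 red _ => u v.
  rewrite mulmxBr mulmxBl -scalemxAr -scalemxAl rep_cat3E.
  have -> : lam *m mxword Phi u *m (mxword Phi w *m (gam *m lam) *m mxword Phi w) *m
      (mxword Phi v *m gam) =
      (lam *m mxword Phi (u ++ w) *m gam) *m (lam *m mxword Phi (w ++ v) *m gam).
    by rewrite !mxword_cat !mulmxA.
  by rewrite !repE -scalar_mxM -cond // scale_scalar_mx mulrC subrr.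
pose g := (p w)^-1 *: (mxword Phi w *m gam); pose l := lam *m mxword Phi w.
have -> : mxword Phi w = g *m l.
  by rewrite /g /l -scalemxAl mulmxA -(mulmxA _ gam) -rank1 scalerA mulVf ?scale1r.
have -> : (g *m l)^T *m (x^T *m y - y^T *m x) *m (g *m l) =
    l^T *m ((x *m g)^T *m (y *m g) - (y *m g)^T *m (x *m g)) *m l.
  by rewrite !mulmxBr !mulmxBl !trmx_mul !mulmxA.
(* Both [x *m g] and [y *m g] are scalars, so they commute and the alternating form cancels. *)
rewrite (mx11_scalar (x *m g)) (mx11_scalar (y *m g)) !tr_scalar_mx.
by rewrite scalar_mxC subrr mulmx0 mul0mx.
Qed.

(** Taking [lam *m mxword Phi u] and [lam] for [x] and [y], and evaluating at [mxword Phi v *m gam]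
    and [gam], turns the two terms of the alternating form into the two sides. *)
Lemma congr_markov_cond w u v :
  (forall x y : 'rV[R]_n,
     (mxword Phi w)^T *m (x^T *m y - y^T *m x) *m mxword Phi w = 0) ->
  p (u ++ w ++ v) * p w = p (u ++ w) * p (w ++ v).
Proof.
move=> H; have := H (lam *m mxword Phi u) lam; rewrite mulmxBr mulmxBl => /eqP.
rewrite subr_eq0 => /eqP /(congr1 (fun X => (mxword Phi v *m gam)^T *m X *m gam)).
have E (x y : 'rV[R]_n) : (mxword Phi v *m gam)^T *m
    ((mxword Phi w)^T *m (x^T *m y) *m mxword Phi w) *m gam =
    (x *m mxword Phi w *m mxword Phi v *m gam)^T *m (y *m mxword Phi w *m gam).
  by rewrite !trmx_mul !mulmxA.
have catE s t : lam *m mxword Phi s *m mxword Phi t = lam *m mxword Phi (s ++ t).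
  by rewrite mxword_cat mulmxA.
rewrite !E !catE !repE !tr_scalar_mx -!scalar_mxM -catA.
by move=> /matrixP/(_ 0 0); rewrite !mxE eqxx !mulr1n => ->; rewrite mulrC.
Qed.

End Representation.

(** * Sums over words with a prescribed tail or beginning *)

Lemma sum_tuple_behead (R : nmodType) (A : finType) m (r : seq A) (F : seq A -> R) :
  size r = m ->
  \sum_(u : m.+1.-tuple A | behead u == r) F u = \sum_a F (a :: r).
Proof.
move=> sr; have st a : size (a :: r) == m.+1 by rewrite /= sr.
rewrite (reindex (fun a => Tuple (st a))) /=; first by apply: eq_bigl => a; apply: eqxx.
exists (fun u => thead u) => [a _|u]; first by [].
rewrite inE => /eqP bu; apply: val_inj => /=.
by case/tupleP: u bu => a u /= <-.
Qed.

Lemma sum_tuple_belast (R : nmodType) (A : finType) m (r : seq A) (F : seq A -> R) :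
  size r = m ->
  \sum_(u : m.+1.-tuple A | take m u == r) F u = \sum_a F (rcons r a).
Proof.
move=> sr; have st a : size (rcons r a) == m.+1 by rewrite size_rcons sr.
rewrite (reindex (fun a => Tuple (st a))) /=.
  by apply: eq_bigl => a; rewrite -cats1 take_size_cat // eqxx.
(* The default [thead u] is never returned, because the tuple is nonempty. *)
exists (fun u => last (thead u) u) => [a _|u]; first by rewrite /= last_rcons.
rewrite inE => /eqP bu; apply: val_inj => /=.
move: (thead u) (size_tuple u) bu => d; case/lastP: (tval u) => [//|s c].
rewrite size_rcons last_rcons => -[ss] <-.
by rewrite -(cats1 s) take_size_cat // cats1.
Qed.

Lemma sum_tuple_word (R : realType) (A : finType) (p : seq A -> R) m :
  inv_prob p -> \sum_(u : m.-tuple A) p u = 1.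
Proof.
move=> Ip; have [p1 _ _ pl] := Ip; elim: m => [|m IHm].
  rewrite (big_pred1 [tuple]) //= => u; by rewrite [u]tuple0; apply/esym/eqP.
rewrite (partition_big (fun u => behead_tuple u) xpredT) //= -IHm.
apply: eq_bigr => r _; rewrite pl -(@sum_tuple_behead _ _ m) ?size_tuple //.
Qed.

(** * The Markov chain on the positive words of length [K] *)

Section Construction.
Context (R : realType) (A : finType) (p : seq A -> R) (m : nat).
Let K := m.+1.
Hypothesis Ip : inv_prob p.
Hypothesis cond : forall u w v, size w = K ->
  p (u ++ w ++ v) * p w = p (u ++ w) * p (w ++ v).
Hypothesis conn : forall u w, 0 < p u -> 0 < p w ->
  exists x, [/\ 0 < p x, (size u < size x)%N, prefix u x & suffix w x].

(** Null words are not states, since transition probabilities divide by the measure of the state. *)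
Let P := {u : K.-tuple A | 0 < p u}.
Let b := #|{: P}|.
Let word (i : 'I_b) : seq A := val (val (enum_val i)).

Let size_word i : size (word i) = K.
Proof. exact: size_tuple. Qed.

Let word_pos i : 0 < p (word i).
Proof. exact: valP (enum_val i). Qed.

Let word_inj : injective word.
Proof. by move=> i j /val_inj/val_inj/enum_val_inj. Qed.

Let word_surj u : size u = K -> 0 < p u -> exists i, word i = u.
Proof.
move=> /eqP su pu; exists (enum_rank (exist _ (Tuple su) pu : P)).
by rewrite /word enum_rankK.
Qed.

Let b_gt0 : (0 < b)%N.
Proof.
have [|r [sr pr]] := word_extend_right Ip K (_ : 0 < p [::]).
  by case: Ip => ->.
by have [i _] := word_surj sr pr; apply: leq_ltn_trans (ltn_ord i).
Qed.

(** Words that are not states receive the default letter 0; injectivity is only claimed on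
    states. *)
Let code (u : seq A) : 'I_b := odflt (Ordinal b_gt0) [pick i | word i == u].

Let wordK i : code (word i) = i.
Proof.
rewrite /code; case: pickP => [j /eqP/word_inj //|/(_ i)].
by rewrite eqxx.
Qed.

Let codeK u : size u = K -> 0 < p u -> word (code u) = u.
Proof. by move=> su pu; have [i <-] := word_surj su pu; rewrite wordK. Qed.

Let code_inj u w : size u = K -> size w = K -> 0 < p u -> 0 < p w ->
  code u = code w -> u = w.
Proof. by move=> su sw pu pw e; rewrite -(codeK su pu) e codeK. Qed.

Let v : 'rV[R]_b := \row_i p (word i).
(** Two states that overlap in [m] letters glue to a word of length [K + 1]; the entry is the
    conditional probability of its last letter given the first [K]. *)
Let M : 'M[R]_b := \matrix_(i, j)
  if behead (word i) == take m (word j) then p (take 1 (word i) ++ word j) / p (word i)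
  else 0.

(** Replaces sums over states by sums over all words of length [K], to which invariance applies. *)
Let sum_word (F : seq A -> R) : (forall u, p u = 0 -> F u = 0) ->
  \sum_i F (word i) = \sum_(u : K.-tuple A) F u.
Proof.
move=> F0; rewrite (bigID (fun u : K.-tuple A => 0 < p u)) /= [X in _ + X]big1 ?addr0.
  rewrite (reindex (fun x : P => enum_rank x)) /=; last first.
    by apply: onW_bij; exact: enum_rank_bij.
  under eq_bigr do rewrite /word enum_rankK.
  rewrite [RHS](reindex_omap (val : P -> _) insub) /=.
    by apply: eq_bigl => x; rewrite (valP x) valK eqxx.
  by move=> u pu; rewrite insubT.
by move=> u /(word_le0 Ip)/F0.
Qed.

Let M_ge0 i j : 0 <= M i j.
Proof. by rewrite mxE; case: ifP => // _; rewrite divr_ge0 ?word_ge0. Qed.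

(** The successors of a state differ only in their last letter, so this is additivity of [p] on the
    right; stationarity below uses predecessors and additivity on the left. *)
Let row_sum i : \sum_j M i j = 1.
Proof.
under eq_bigr do rewrite mxE.
pose F u := if behead (word i) == take m u then p (take 1 (word i) ++ u) / p (word i) else 0.
rewrite (sum_word (F := F)); last first.
  move=> u pu0; rewrite /F; case: ifP => // _; apply/eqP; rewrite mulf_eq0 eq_le.
  by rewrite word_ge0 // andbT -pu0 word_cat_ler.
rewrite -big_mkcond /=; under eq_bigl do rewrite eq_sym.
rewrite (sum_tuple_belast (fun u => p (take 1 (word i) ++ u) / p (word i))); last first.
  by rewrite size_behead size_word.
rewrite -mulr_suml; under eq_bigr do rewrite -rcons_cat -drop1 cat_take_drop.
have [_ _ <- _] := Ip; by rewrite divff // gt_eqF.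
Qed.

Let stationary : v *m M = v.
Proof.
apply/rowP => j; rewrite !mxE.
pose F u := if behead u == take m (word j) then p (take 1 u ++ word j) else 0.
rewrite (eq_bigr (fun i => F (word i))) => [|i _]; last first.
  rewrite !mxE /F; case: ifP => _; last by rewrite mulr0.
  by rewrite mulrC divfK // gt_eqF.
rewrite (sum_word (F := F)); last first.
  move=> u pu0; rewrite /F; case: ifP => // /eqP e; apply/eqP; rewrite eq_le.
  rewrite word_ge0 // andbT -pu0 -[X in _ <= p X](cat_take_drop 1) drop1 e.
  by rewrite -{1}(cat_take_drop m (word j)) catA word_cat_lel.
rewrite -big_mkcond /=.
rewrite (sum_tuple_behead (fun u => p (take 1 u ++ word j))); last first.
  by rewrite size_takel // size_word.
have [_ _ _ /(_ (word j)) ->] := Ip.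
by apply: eq_bigr => a _; rewrite /= take0.
Qed.

Let M_code h x : (K <= size x)%N -> pos_factors p K (h :: x) ->
  M (code (take K (h :: x))) (code (take K x)) * p (take K (h :: x)) =
  p (h :: take K x).
Proof.
move=> lex; rewrite /pos_factors slide_cons //=; last by rewrite ltnW.
case: x lex => [//|h' x lex]; rewrite slide_cons //= => /and3P[ph px _].
have sh : size (h :: take m (h' :: x)) = K by rewrite /= size_takel // ltnW.
rewrite mxE !codeK //; last by rewrite /= size_takel.
have -> : behead (h :: take m (h' :: x)) = take m (h' :: take m x).
  by rewrite -[h' :: take m x]/(take K (h' :: x)) take_takel.
by rewrite eqxx /= take0 divfK // gt_eqF.
Qed.

(** A telescoping product of conditional probabilities. *)
Let trans_code h x : (K <= size (h :: x))%N -> pos_factors p K (h :: x) ->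
  trans M (code (take K (h :: x))) (slide K code x) * p (take K (h :: x)) = p (h :: x).
Proof.
elim: x h => [|h' x IHx] h lex gx.
  by rewrite slide_small //= mul1r; case: (m) lex.
have [ltK|geK] := leqP K (size (h' :: x)); last first.
  by rewrite slide_small // mul1r take_oversize.
have /andP[ph gx'] : (0 < p (take K (h :: h' :: x))) && pos_factors p K (h' :: x).
  by move: gx; rewrite /pos_factors slide_cons.
have px' : 0 < p (take K (h' :: x)).
  by move: gx'; rewrite /pos_factors slide_cons // => /andP[].
rewrite slide_cons // [trans _ _ _]/= mulrAC (M_code ltK gx).
(* After multiplication by the measure of the second window, the claim is [cond] with that window as
   the middle word. *)
apply: (mulIf (lt0r_neq0 px')); rewrite -mulrA IHx //.
have := @cond [:: h] (take K (h' :: x)) (drop K (h' :: x)).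
by rewrite cat_take_drop => -> //; rewrite size_takel.
Qed.

Let cyl_code x : (K <= size x)%N -> pos_factors p K x ->
  markov_cyl M v (slide K code x) = p x.
Proof.
case: x => [//|h x] lex gx; rewrite slide_cons //= mxE codeK.
- by rewrite mulrC trans_code.
- by rewrite /= size_takel.
- by move: gx; rewrite /pos_factors slide_cons //= => /andP[].
Qed.

(** The states on a path of nonzero weight overlap consistently and glue to a word whose windows are
    these states, which is what [cyl_code] requires. *)
Let trans_neq0 a w : trans M a w != 0 -> exists x,
  [/\ size x = (size w + K)%N, pos_factors p K x, slide K code x = a :: w & take K x = word a].
Proof.
elim: w a => [|c w IHw] a /=.
  move=> _; exists (word a); split; rewrite ?size_word // ?slide_self ?wordK //.
    exact: pos_factors_gt0.
  by rewrite take_oversize ?size_word.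
rewrite mulf_eq0 negb_or => /andP[Mac /IHw[x [sx gx ex tx]]].
move: Mac; rewrite mxE; case: ifP => [/eqP e _|_]; last by rewrite eqxx.
have leKx : (K <= size x)%N by rewrite sx leq_addl.
have [h th] : exists h, take K (h :: x) = word a.
  case ea: (word a) (size_word a) e => [//|h r] _ /=.
  by rewrite -tx take_takel // => ->; exists h.
exists (h :: x); split=> //; first by rewrite /= sx.
  rewrite /pos_factors slide_cons //; last exact: leqW.
  by rewrite th /= word_pos.
by rewrite slide_cons ?th ?wordK ?ex //; apply: leqW.
Qed.

Let cyl_push w : markov_cyl M v w = push K code p w.
Proof.
case: w => [|a w].
  (* Words of length [m] contain no window, so the empty code word collects their total mass 1. *)
  rewrite (pushE _ (m := m)) /=; last by rewrite add0n subn1.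
  rewrite -(sum_tuple_word m Ip); apply: eq_bigl => u.
  by rewrite slide_small ?size_tuple.
have [t0|/trans_neq0[x [sx gx ex _]]] := eqVneq (trans M a w) 0; last first.
  by rewrite -ex (push_slide Ip) // ?cyl_code // sx leq_addl.
(* A positive preimage would, by [cyl_code], give the path nonzero weight. *)
rewrite /= t0 mulr0; apply/esym/eqP; rewrite eq_le; apply/andP; split; last first.
  by apply: sumr_ge0 => u _; apply: word_ge0.
rewrite leNgt; apply/negP => /(push_gt0 Ip)[x [sx px ex]].
have lex : (K <= size x)%N by rewrite sx /= addSn subn1 leq_addl.
have := px; rewrite -cyl_code ?(pos_factors_gt0 Ip) // ex /= t0 mulr0 ltxx //.
Qed.

Let irreducible_code : irreducible_mx M.
Proof.
move=> i j; have [x [px ltx /prefixP[y ey] /suffixP[z ez]]] := conn (word_pos i) (word_pos j).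
have lex : (K <= size x)%N by rewrite ey size_cat size_word leq_addr.
move: ltx; rewrite ey size_cat -addn1 leq_add2l => y0.
have exi : exists w, [/\ slide K code x = i :: w, (size w = size y) & last i w = j].
  have [s [t [_ _ e3]]] := slide_split code [::] y (size_word i) (ltn0Sn m).
  have [s' [t' [_ e2 _]]] := slide_split code z [::] (size_word j) (ltn0Sn m).
  exists t; rewrite ey e3 wordK; split=> //.
    have := size_slide K code (word i ++ y); rewrite e3 size_cat size_word /= /K; lia.
  have -> : last i t = last i (code (word i) :: t) by rewrite /= wordK.
  by rewrite -e3 -ey ez e2 last_rcons wordK.
have [w [ew sw lw]] := exi.
have tw : 0 < trans M i w.
  have := px; rewrite -cyl_code ?(pos_factors_gt0 Ip) // ew /=.
  by rewrite !lt0r trans_ge0 // andbT mulf_eq0 negb_or; case/andP => /andP[].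
(* The path has [size y] transitions, and [irreducible_mx] adds one to its exponent; [y] is nonempty
   by the strict inequality in [conn]. *)
exists (size y).-1; rewrite prednK // -sw -lw.
exact: lt_le_trans tw (trans_expmx _ _ M_ge0).
Qed.

(** Converse to [k_markov_cond] and [k_markov_connected] taken together. *)
Lemma cond_k_markov : k_markov p K.
Proof.
exists b, code, M, v; split; [split | exact: code_inj | exact: cyl_push].
- by split; [exact: M_ge0 | exact: row_sum].
- exact: irreducible_code.
- by move=> j; rewrite mxE word_ge0.
- under eq_bigr do rewrite mxE.
  by rewrite (sum_word (F := p)) // sum_tuple_word.
- exact: stationary.
Qed.

End Construction.

Theorem mainTheorem1 (R : realType) (A : finType) (p : seq A -> R)
  (n : nat) (lam : 'rV[R]_n) (Phi : A -> 'M[R]_n) (gam : 'cV[R]_n) :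
  inv_prob p -> sofic p ->
  lin_rep p lam Phi gam -> reduced_rep lam Phi gam ->
  ~ k_markov p (2 ^ (n ^ 2 - 1))%N ->
  forall k : nat, (1 <= k)%N -> ~ k_markov p k.
Proof.
move=> Ip _ Lp red notK k k0 Mk; apply: notK.
set K := (2 ^ (n ^ 2 - 1))%N.
(* For positive [n] this is [d < 2 ^ d] with [d = n ^ 2 - 1]. *)
have leK : (n ^ 2 <= K)%N.
  by rewrite /K; case: (n ^ 2)%N => // d; rewrite subn1 ltn_expl.
have K0 : (0 < K)%N by rewrite expn_gt0.
(* Connectedness does not mention the order, so it passes unchanged from [k] to [K]. *)
rewrite -(prednK K0); apply: cond_k_markov => // [u w v|]; last first.
  exact: k_markov_connected Mk.
(* The Markov identity at length [k] becomes a congruence identity, which is carried over to length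
   [K] and translated back. *)
rewrite (prednK K0) => sw; apply: (congr_markov_cond Lp) => x y.
apply: (@congr_mxword_eq0 _ _ _ _ k); last by rewrite sw.
apply: (markov_cond_congr Ip Lp) => // u' w' v' sw'.
exact: (k_markov_cond Ip k0 Mk).
Qed.
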